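(* Assume the data sequence $(\omega_t)$ satisfies the drift bound $\|\omega_{t+1}-\omega_t\|_2\le\nu$ for all $t$, and that noisy observations $y_t=\omega_t+\xi_t$ are available, with $\xi_t$ i.i.d. sub-Gaussian with proxy $\sigma^2$. Let $\hat\omega_t^{(W)}:=\frac1W\sum_{s=t-W+1}^ty_s$ and $\hat\lambda_t^{(W)}:=\lambda^\star(\hat\omega_t^{(W)})$, and suppose that at time $t$ the data $\omega_t$ satisfies the margin condition $\lambda^\star(\omega_t)\in\mathcal{R}_{r_t}^\circ$ with margin $\rho_{r_t}$ uniformly bounded below by $\rho>0$. Then for any $\alpha\in(0,1)$ the choice $$W^\star=\Bigl(\frac{2\sigma^2\log(2/\alpha)}{\nu^2}\Bigr)^{1/3}$$ yields the bound $$\|\hat\lambda_t^{(W^\star)}-\lambda^\star(\omega_t)\|_2\le\kappa\bigl(c_1\,\sigma^{2/3}\nu^{1/3}(\log(2/\alpha))^{1/3}\bigr)$$ with probability at least $1-\alpha$ for some absolute constant $c_1$. In particular, if the drift satisfies $$\nu<\nu_{\max}:=\frac1{c_1^3\sigma^2\log(2/\alpha)}\Bigl(\frac{\rho}{C_\Psi\,\kappa}\Bigr)^3,$$ then $\mathbb{P}\bigl(\Psi(\hat\lambda_t^{(W^\star)})=r_t\bigr)\ge1-\alpha$.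
   Context: Problem (P$_\omega$), $\omega\in\Omega\subset\mathbb{R}^d$: minimize $f(x;\omega)$ over $x\in\mathbb{R}^n$ subject to $g_i(x;\omega)\le0$ ($i=1,\dots,m$), $h_j(x;\omega)=0$ ($j=1,\dots,p$), with $f,g_i,h_j$ at least $C^2$ jointly in $(x,\omega)$. The KKT solution map assigns to $\omega$ the inequality multiplier vector $\lambda^\star(\omega)\in\mathbb{R}^m_+$ of a KKT triple of (P$_\omega$), i.e. $(x^\star,\lambda^\star,\mu^\star)$ with $\nabla f+\sum_i\lambda_i^\star\nabla g_i+\sum_j\mu_j^\star\nabla h_j=0$; $g_i\le0$, $\lambda^\star_i\ge0$, $\lambda_i^\star g_i=0$; $h_j=0$ at $x^\star$. Standing assumption at the KKT triple: LICQ (gradients of active inequality constraints and of equality constraints linearly independent), SOSC (Hessian in $x$ of the Lagrangian $f+\sum\lambda_i^\star g_i+\sum\mu_j^\star h_j$ is positive on nonzero $d$ with $\nabla g_i^\top d\le0$ for active $i$, $\nabla g_i^\top d=0$ for $i$ with $\lambda_i^\star\ne0$, $\nabla h_j^\top d=0$ for all $j$), and strict complementarity ($\lambda^\star_i>0$ for every active $i$). $\kappa$ is the local Lipschitz constant of the KKT solution map $\omega\mapsto\lambda^\star(\omega)$. For $\lambda\in\mathbb{R}^m_+$ let $L(\lambda)=\sum_i\lambda_i$; $\bar\lambda=\lambda/L(\lambda)$ if $L(\lambda)>0$, $\bar\lambda=0$ otherwise; $\bar\lambda_{(1)}\ge\cdots\ge\bar\lambda_{(m)}$ the sorted entries. Fix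 $\Theta=(\delta,\theta,\gamma,k)$ with $0<\delta<\tfrac12$, $\theta\in(\tfrac12,1)$, $\gamma\in(0,1)$, $k\in\{1,\dots,m-1\}$. $\Sigma_k(\lambda)=\sum_{j=1}^k\bar\lambda_{(j)}$, $\sigma_\delta(\lambda)=\frac1m|\{i:\bar\lambda_i>\delta\}|$, $\tau(\lambda)=\bar\lambda_{(2)}$. Core regimes in $\mathbb{R}^m_+$: $\mathcal{R}_{\mathrm{unc}}^\circ=\{L<\delta\}$; $\mathcal{R}_{\mathrm{res}}^\circ=\{L>\delta,\Sigma_k>\theta\}$; $\mathcal{R}_{\mathrm{sat}}^\circ=\{L>\delta,\Sigma_k<\theta,\sigma_\delta>\gamma\}$; $\mathcal{R}_{\mathrm{coup}}^\circ=\{L>\delta,\Sigma_k<\theta,\sigma_\delta<\gamma,\tau>\delta\}$. $\Psi(\lambda)$ is the unique $r\in\{\mathrm{unc},\mathrm{res},\mathrm{sat},\mathrm{coup}\}$ with $\lambda\in\mathcal{R}_r^\circ$ if it exists, and $\mathrm{hyb}$ otherwise. $r_t:=\Psi(\lambda^\star(\omega_t))$. Margin: for $\lambda\in\mathcal{R}_r^\circ$, $\rho_r(\lambda)$ is the minimum of those among $|L(\lambda)-\delta|$, $|\Sigma_k(\lambda)-\theta|$, $|\sigma_\delta(\lambda)-\gamma|$, $|\tau(\lambda)-\delta|$ whose corresponding inequality appears in the definition of $\mathcal{R}_r^\circ$; $\rho_{r_t}=\rho_{r_t}(\lambda^\star(\omega_t))$. $C_\Psi$ is the (finite) joint Lipschitz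 constant of $\lambda\mapsto(L,\Sigma_k,\sigma_\delta,\tau)$ on a bounded neighborhood of the true multiplier (from $\|\cdot\|_2$ to $\|\cdot\|_\infty$).
   Formalization: c_1 is absolute if sigma^2 bounds the trace of a matrix proxy; for a directional proxy it becomes c_1 sqrt(d), as an absolute one fails for N(0, sigma^2 I_d). kappa, C_Psi must hold on balls covering the errors (kappa's in Omega). W is W* rounded to an integer >= 1, W <= t+1. *)

(* Defs.v *)
From HB Require Import structures.
From mathcomp Require Import all_boot all_order all_algebra.
From mathcomp Require Import all_classical all_reals all_analysis.

Set Implicit Arguments.
Unset Strict Implicit.
Unset Printing Implicit Defensive.

Import Order.TTheory GRing.Theory Num.Theory.
Import numFieldNormedType.Exports.

Local Open Scope classical_set_scope.
Local Open Scope ring_scope.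

(* The library norm on matrices is the sup norm, so the Euclidean one is
   defined here. *)
Section Euclidean.
Variables (R : realType).

Definition dot n (u v : 'rV[R]_n) : R := (u *m v^T) 0 0.

Definition l2norm n (v : 'rV[R]_n) : R := Num.sqrt (dot v v).

Definition l2ball n (c : 'rV[R]_n) (r : R) : set 'rV[R]_n :=
  [set x | l2norm (x - c) <= r].

Definition l2lipschitz n m (K : R) (A : set 'rV[R]_n)
    (F : 'rV[R]_n -> 'rV[R]_m) : Prop :=
  forall x y, A x -> A y -> l2norm (F x - F y) <= K * l2norm (x - y).

Definition nneg n : set 'rV[R]_n := [set v | forall i, 0 <= v 0 i].

End Euclidean.

(* On an open set of a finite-dimensional space, existence and continuity of
   all iterated directional derivatives up to order k is the class C^k. *)
Fixpoint Ck (R : realType) (V : normedModType R) (k : nat) (U : set V)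
    (F : V -> R) : Prop :=
  (forall z, U z -> {for z, continuous F}) /\
  match k with
  | 0%N => True
  | k'.+1 =>
      forall v, (forall z, U z -> derivable F z v) /\ Ck k' U ('D_v F)
  end.

Record program (R : realType) (n d m p : nat) := Program {
  objf : 'rV[R]_n -> 'rV[R]_d -> R ;
  ineqf : 'I_m -> 'rV[R]_n -> 'rV[R]_d -> R ;
  eqf : 'I_p -> 'rV[R]_n -> 'rV[R]_d -> R
}.

Section Program.
Variables (R : realType) (n d m p : nat).
Implicit Types (Q : program R n d m p) (w : 'rV[R]_d) (x : 'rV[R]_n).
Implicit Types (lam : 'rV[R]_m) (mu : 'rV[R]_p) (F : 'rV[R]_n -> R).

(* Omega need not be open: smoothness is on an open set containing
   R^n x Omega. *)
Definition jointly_C2 (Omega : set 'rV[R]_d)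
    (F : 'rV[R]_n -> 'rV[R]_d -> R) : Prop :=
  exists U : set ('rV[R]_n * 'rV[R]_d)%type,
    [/\ open U, setT `*` Omega `<=` U & Ck 2 U (fun z => F z.1 z.2)].

Definition C2_program (Omega : set 'rV[R]_d) Q : Prop :=
  [/\ jointly_C2 Omega (objf Q), forall i, jointly_C2 Omega (ineqf Q i)
    & forall j, jointly_C2 Omega (eqf Q j)].

Definition grad F x : 'rV[R]_n := \row_i 'D_(delta_mx 0 i) F x.

Definition hess F x : 'M[R]_n :=
  \matrix_(i, j) 'D_(delta_mx 0 i) ('D_(delta_mx 0 j) F) x.

Definition lagrangian Q w lam mu : 'rV[R]_n -> R := fun x =>
  objf Q x w + \sum_i lam 0 i * ineqf Q i x w + \sum_j mu 0 j * eqf Q j x w.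

Definition KKT Q w x lam mu : Prop :=
  [/\ grad (objf Q ^~ w) x + \sum_i lam 0 i *: grad (ineqf Q i ^~ w) x
        + \sum_j mu 0 j *: grad (eqf Q j ^~ w) x = 0,
      forall i, [/\ ineqf Q i x w <= 0, 0 <= lam 0 i
                  & lam 0 i * ineqf Q i x w = 0]
    & forall j, eqf Q j x w = 0].

Definition active Q w x : pred 'I_m := fun i => ineqf Q i x w == 0.

Definition LICQ Q w x : Prop :=
  free ([seq grad (ineqf Q i ^~ w) x | i <- enum 'I_m & active Q w x i]
        ++ [seq grad (eqf Q j ^~ w) x | j <- enum 'I_p]).

Definition SOSC Q w x lam mu : Prop :=
  forall v : 'rV[R]_n, v != 0 ->
    (forall i, active Q w x i -> dot (grad (ineqf Q i ^~ w) x) v <= 0) ->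
    (forall i, lam 0 i != 0 -> dot (grad (ineqf Q i ^~ w) x) v = 0) ->
    (forall j, dot (grad (eqf Q j ^~ w) x) v = 0) ->
    0 < dot (v *m hess (lagrangian Q w lam mu) x) v.

Definition strict_complementarity Q w x lam : Prop :=
  forall i, active Q w x i -> 0 < lam 0 i.

Definition KKT_solution_map (Omega : set 'rV[R]_d) Q
    (lams : 'rV[R]_d -> 'rV[R]_m) : Prop :=
  forall w, Omega w -> exists x mu, KKT Q w x (lams w) mu.

Definition regular_at Q w lam : Prop :=
  exists x mu, [/\ KKT Q w x lam mu, LICQ Q w x, SOSC Q w x lam mu
                 & strict_complementarity Q w x lam].

End Program.

Variant regime := unc | res | sat | coup | hyb.

Section Regimes.
Variables (R : realType) (m : nat).
Variables (delta theta gamma : R) (k : nat).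
Implicit Types lam : 'rV[R]_m.

Definition load lam : R := \sum_i lam 0 i.

Definition normalized lam : 'rV[R]_m :=
  if 0 < load lam then (load lam)^-1 *: lam else 0.

(* sorted_entry lam j is the (j+1)-st largest entry of the normalized vector. *)
Definition sorted_entry lam (j : nat) : R :=
  nth 0 (sort (fun a b : R => b <= a)
              [seq normalized lam 0 i | i <- enum 'I_m]) j.

Definition top_share lam : R := \sum_(j < k) sorted_entry lam j.

Definition saturation lam : R :=
  #|[set i : 'I_m | (delta < normalized lam 0 i)%R]%SET|%:R / m%:R.

Definition second_share lam : R := sorted_entry lam 1.

Definition core (r : regime) lam : bool :=
  [forall i, 0 <= lam 0 i] &&
  match r with
  | unc => load lam < delta
  | res => (delta < load lam) && (theta < top_share lam)
  | sat => [&& delta < load lam, top_share lam < theta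
             & gamma < saturation lam]
  | coup => [&& delta < load lam, top_share lam < theta,
                saturation lam < gamma & delta < second_share lam]
  | hyb => false
  end.

Definition Psi lam : regime :=
  if core unc lam then unc else if core res lam then res
  else if core sat lam then sat else if core coup lam then coup else hyb.

(* The cores are pairwise disjoint, so the order of the tests in Psi is
   immaterial. *)
Lemma PsiP (r : regime) lam : r <> hyb -> (Psi lam = r <-> core r lam).
Proof.
rewrite /Psi /core; case: [forall i, _] => /=; last by case: r.
case: (ltgtP (load lam) delta) => _ /=; case: (ltgtP (top_share lam) theta) => _;
  case: (ltgtP (saturation lam) gamma) => _;
  case: (delta < second_share lam); by case: r.
Qed.

Definition margin (r : regime) lam : R :=
  let eL := `|load lam - delta| in
  let eS := `|top_share lam - theta| in
  let es := `|saturation lam - gamma| in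
  let et := `|second_share lam - delta| in
  match r with
  | unc => eL
  | res => Num.min eL eS
  | sat => Num.min eL (Num.min eS es)
  | coup => Num.min eL (Num.min eS (Num.min es et))
  | hyb => 0
  end.

(* Lipschitz bound for lam |-> (L, Sigma_k, sigma_delta, tau), from the
   Euclidean norm to the sup norm of R^4. *)
Definition features_lipschitz (C : R) (A : set 'rV[R]_m) : Prop :=
  forall x y, A x -> A y ->
    Num.max `|load x - load y| (Num.max `|top_share x - top_share y|
      (Num.max `|saturation x - saturation y|
        `|second_share x - second_share y|)) <= C * l2norm (x - y).

End Regimes.

(* How a single number sigma^2 bounds the sub-Gaussian behaviour of a noise
   vector in R^d: either every unit direction has variance proxy sigma^2, or
   sigma^2 bounds the trace of a matrix proxy, i.e. it is the proxy of the
   vector as a whole.  For d = 1 the two coincide.  The Euclidean norm of a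
   directionally sub-Gaussian vector is of order sigma * sqrt d, which is what
   dim_factor records. *)
Variant proxy_kind := Directional | Total.

Definition dim_factor (R : realType) (pk : proxy_kind) (d : nat) : R :=
  match pk with Directional => Num.sqrt d%:R | Total => 1 end.

Section Noise.
Context (dT : measure_display) (T : measurableType dT) (R : realType).
Variables (P : probability T R) (d : nat).
Implicit Types (X : T -> 'rV[R]_d) (xi : nat -> T -> 'rV[R]_d).

Definition borel : set (set 'rV[R]_d) := <<s [set U | open U] >>.

Definition random_vector X : Prop :=
  forall B, borel B -> measurable (X @^-1` B).

Definition independent xi : Prop :=
  forall (J : seq nat) (B : nat -> set 'rV[R]_d),
    uniq J -> (forall s, borel (B s)) ->
    P (\bigcap_(s in [set` J]) (xi s @^-1` B s)) =
    (\prod_(s <- J) P (xi s @^-1` B s))%E.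

Definition identically_distributed xi : Prop :=
  forall s s' B, borel B -> P (xi s @^-1` B) = P (xi s' @^-1` B).

Definition iid xi : Prop :=
  [/\ forall s, random_vector (xi s), independent xi
    & identically_distributed xi].

(* The bound for all u forces the mean to be 0. *)
Definition subgaussian_mx (G : 'M[R]_d) X : Prop :=
  forall u : 'rV[R]_d,
    ('E_P[fun t => expR (dot u (X t))] <= (expR (dot (u *m G) u / 2))%:E)%E.

Definition subgaussian (pk : proxy_kind) (sigma : R) X : Prop :=
  match pk with
  | Directional => subgaussian_mx (sigma ^+ 2)%:M X
  | Total => exists2 G : 'M[R]_d, \tr G <= sigma ^+ 2 & subgaussian_mx G X
  end.

(* "The event A holds with probability at least q", without presupposing that
   A is measurable. *)
Definition prob_ge (A : set T) (q : R) : Prop :=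
  exists E, [/\ measurable E, E `<=` A & (q%:E <= P E)%E].

End Noise.

Section Window.
Variables (R : realType) (d : nat).

Definition window_mean (W t : nat) (y : nat -> 'rV[R]_d) : 'rV[R]_d :=
  W%:R^-1 *: \sum_(t.+1 - W <= s < t.+1) y s.

Definition Wstar (sigma nu alpha : R) : R :=
  (2 * sigma ^+ 2 * ln (2 / alpha) / nu ^+ 2) `^ (1 / 3).

(* The optimal window is a real number; W is either of its integer roundings
   (W = Wstar when Wstar is an integer). *)
Definition rounds_to (W : nat) (w : R) : Prop := (0 < W)%N /\ `|W%:R - w| < 1.

Definition data_error (c sigma nu alpha : R) : R :=
  c * sigma `^ (2 / 3) * nu `^ (1 / 3) * ln (2 / alpha) `^ (1 / 3).

Definition nu_max (c sigma alpha rho CPsi kappa : R) : R :=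
  1 / (c ^+ 3 * sigma ^+ 2 * ln (2 / alpha)) * (rho / (CPsi * kappa)) ^+ 3.

End Window.

(* Main.v *)
Require Import Defs.
From HB Require Import structures.
From mathcomp Require Import all_boot all_order all_algebra.
From mathcomp Require Import all_classical all_reals all_analysis.
From mathcomp Require Import measurable_realfun finmap zify ring lra.

(** The estimation error of the window mean splits into a bias and a noise
term, and the window length balances the two.

Bias: consecutive data differ by at most nu, so each of the W data in the
window is within (W - 1) * nu of the current one, and so is their mean
([window_bias]).

Noise: let S be the sum of the W noise vectors.  By independence the moment
generating functions multiply ([independent_integral_prod]), so S is
sub-Gaussian, with proxy matrix the sum of the individual ones
([subgaussian_mx_sum]).  Only the trace of that matrix is used from then on.
It is at most W * tau^2, where tau = sigma for a total proxy and
tau = sigma * sqrt d for a directional one ([subgaussian_trace]); this is where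
the dimension factor enters, and the two kinds of proxy are treated alike
afterwards.  A deviation inequality for |S| that depends on the trace alone
([subgaussian_mx_tail]) follows from moments of order 2k along the coordinates:
Jensen's inequality with weights proportional to the variance proxies of the
coordinates bounds |S|^(2k) by a weighted average of one-dimensional exponential
moments ([l2_expr_le_expR]), without a union bound and hence without a
logarithm of the dimension.  With k about log (2 / alpha) this gives
|S|^2 <= 12 e^2 W tau^2 log (2 / alpha) outside an event of probability at most
alpha ([noise_bound]).

Balance: put A = (sigma^2 nu log (2 / alpha))^(1/3).  For W within 1 of Wstar,
(W - 1) * nu <= 2 A and sigma^2 log (2 / alpha) <= 4 A^2 W ([window_balance]).
The bias is thus at most 2 A, and the noise |S| / W at most
sqrt 48 e A <= 7 e A times the dimension factor, so c1 = 2 + 7 e works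
([window_estimate]).

The multiplier bound is then the Lipschitz property of the multiplier map.  For
the regime, nu < nu_max is the cube of CPsi * kappa * err < rho
([data_error_lt_margin]), so no feature that matters for the regime crosses its
threshold ([core_stable]). *)

Import Order.TTheory GRing.Theory Num.Theory.
Import numFieldNormedType.Exports.

Set Implicit Arguments.
Unset Strict Implicit.
Unset Printing Implicit Defensive.

Local Open Scope classical_set_scope.
Local Open Scope ring_scope.

(** * Euclidean geometry of row vectors *)

Lemma dotE (R : realType) n (u v : 'rV[R]_n) : dot u v = \sum_i u 0 i * v 0 i.
Proof. by rewrite /dot mxE; apply: eq_bigr => i _; rewrite mxE. Qed.

Lemma dotC (R : realType) n (u v : 'rV[R]_n) : dot u v = dot v u.
Proof. by rewrite !dotE; apply: eq_bigr => i _; rewrite mulrC. Qed.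

Lemma dotDl (R : realType) n (u v w : 'rV[R]_n) :
  dot (u + v) w = dot u w + dot v w.
Proof. by rewrite /dot mulmxDl mxE. Qed.

Lemma dotDr (R : realType) n (u v w : 'rV[R]_n) :
  dot u (v + w) = dot u v + dot u w.
Proof. by rewrite dotC dotDl !(dotC _ u). Qed.

Lemma dotZl (R : realType) n a (u v : 'rV[R]_n) : dot (a *: u) v = a * dot u v.
Proof. by rewrite /dot -scalemxAl mxE. Qed.

Lemma dotZr (R : realType) n a (u v : 'rV[R]_n) : dot u (a *: v) = a * dot u v.
Proof. by rewrite dotC dotZl dotC. Qed.

Lemma dot_sumr (R : realType) n (I : Type) (s : seq I) (u : 'rV[R]_n)
    (F : I -> 'rV[R]_n) :
  dot u (\sum_(i <- s) F i) = \sum_(i <- s) dot u (F i).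
Proof.
apply: (big_morph (dot u)); first exact: dotDr.
by rewrite -(scale0r (0 : 'rV[R]_n)) dotZr mul0r.
Qed.

Lemma dot_ge0 (R : realType) n (u : 'rV[R]_n) : 0 <= dot u u.
Proof. by rewrite dotE sumr_ge0// => i _; rewrite -expr2 sqr_ge0. Qed.

Lemma l2norm_ge0 (R : realType) n (u : 'rV[R]_n) : 0 <= l2norm u.
Proof. exact: sqrtr_ge0. Qed.

Lemma l2norm_sqr (R : realType) n (u : 'rV[R]_n) : l2norm u ^+ 2 = dot u u.
Proof. by rewrite sqr_sqrtr// dot_ge0. Qed.

Lemma l2norm0 (R : realType) n : l2norm (0 : 'rV[R]_n) = 0.
Proof. by rewrite /l2norm -(scale0r (0 : 'rV[R]_n)) dotZr mul0r sqrtr0. Qed.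

Lemma l2normZ (R : realType) n a (u : 'rV[R]_n) :
  l2norm (a *: u) = `|a| * l2norm u.
Proof.
by rewrite /l2norm dotZl dotZr mulrA -expr2 sqrtrM ?sqr_ge0// sqrtr_sqr.
Qed.

Lemma dot_le_l2norm (R : realType) n (u v : 'rV[R]_n) :
  dot u v <= l2norm u * l2norm v.
Proof.
have p0 := dot_ge0 u; have q0 := dot_ge0 v.
suff h : dot u v ^+ 2 <= dot u u * dot v v.
  rewrite /l2norm -sqrtrM//; apply: le_trans (ler_norm _) _.
  by rewrite -sqrtr_sqr ler_wsqrtr.
have := dot_ge0 (dot v v *: u - dot u v *: v).
rewrite -scaleNr !(dotDl, dotDr, dotZl, dotZr) (dotC v u).
have [v0|v0] := eqVneq (dot v v) 0; last first.
  have {}q0 : 0 < dot v v by rewrite lt_neqAle eq_sym v0.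
  move=> h; rewrite -(ler_pM2l q0); nra.
rewrite v0 !mulr0 => _.
suff -> : dot u v = 0 by rewrite expr0n.
move: v0; rewrite !dotE => /eqP; rewrite psumr_eq0; last first.
  by move=> i _; rewrite -expr2 sqr_ge0.
move=> /allP vi0; rewrite big1// => i _.
have /implyP/(_ isT) := vi0 i (mem_index_enum i).
by rewrite -expr2 sqrf_eq0 => /eqP->; rewrite mulr0.
Qed.

Lemma ler_l2normD (R : realType) n (u v : 'rV[R]_n) :
  l2norm (u + v) <= l2norm u + l2norm v.
Proof.
rewrite -(@ler_pXn2r _ 2)// ?nnegrE ?addr_ge0 ?l2norm_ge0//.
rewrite sqrrD !l2norm_sqr !(dotDl, dotDr) (dotC v u).
have := dot_le_l2norm u v; lra.
Qed.

Lemma ler_l2norm_sum (R : realType) n (I : Type) (s : seq I) (P : pred I)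
    (F : I -> 'rV[R]_n) :
  l2norm (\sum_(i <- s | P i) F i) <= \sum_(i <- s | P i) l2norm (F i).
Proof.
elim/big_rec2: _ => [|i y x _ le_xy]; first by rewrite l2norm0.
by apply: le_trans (ler_l2normD _ _) _; rewrite lerD2l.
Qed.

Lemma dot_deltal (R : realType) d (i : 'I_d) (v : 'rV[R]_d) :
  dot (delta_mx 0 i) v = v 0 i.
Proof. by rewrite /dot -rowE !mxE. Qed.

Lemma dot_delta_mulmx (R : realType) d (a : R) (i : 'I_d) (G : 'M[R]_d) :
  dot ((a *: delta_mx 0 i) *m G) (a *: delta_mx 0 i) = a ^+ 2 * G i i.
Proof.
rewrite -scalemxAl dotZl dotZr mulrA -expr2 -rowE dotC dot_deltal.
by rewrite mxE.
Qed.

(** * Product rule for independent random vectors *)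

(** Makes the Borel sets of R^d the measurable sets of a type, so that a random
vector is a measurable function in the usual sense. *)
Definition borel_rV (R : realType) (d : nat) : Type :=
  g_sigma_algebraType [set U : set 'rV[R]_d | open U].
HB.instance Definition _ R d := Measurable.on (borel_rV R d).

Lemma random_vector_measurable dT (T : measurableType dT) (R : realType) d
    (X : T -> borel_rV R d) :
  random_vector X -> measurable_fun setT X.
Proof. by move=> mX _ B mB; rewrite setTI; exact: mX. Qed.

Lemma continuous_borel_measurable (R : realType) d (f : borel_rV R d -> R) :
  continuous (f : 'rV[R]_d -> R) -> measurable_fun setT f.
Proof.
move=> /continuousP cf; apply: (measurability _ (RGenOpens.measurableE R)).
move=> _ [_ [a [b ->] <-]]; rewrite setTI; apply: sub_sigma_algebra.
exact/cf/interval_open.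
Qed.

Lemma measurable_coord (R : realType) d (i : 'I_d) :
  measurable_fun setT (fun v : borel_rV R d => (v : 'rV[R]_d) 0 i).
Proof.
by apply: continuous_borel_measurable; exact: coord_continuous.
Qed.

Lemma measurable_dot (R : realType) d (u : 'rV[R]_d) :
  measurable_fun setT (dot u : borel_rV R d -> R).
Proof.
rewrite (_ : (dot u : _ -> R) = fun v : 'rV_d => \sum_i u 0 i * v 0 i); last first.
  by apply/funext => v; rewrite dotE.
apply: measurable_sum => i; apply: measurable_funM => //.
exact: measurable_coord.
Qed.

Import HBNNSimple.

(** First step of [integral_mul_indep_factor]: by linearity, a relation known
for indicators of sets holds for simple functions. *)
Lemma integral_mul_nnsfun dT (T : measurableType dT) (R : realType)
    (P : {measure set T -> \bar R}) d' (T' : measurableType d')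
    (X : T -> T') (h : T -> R) (g : {nnsfun T' >-> R}) (c : R) :
  measurable_fun setT X -> measurable_fun setT h ->
  (forall x, 0 <= h x) -> 0 <= c ->
  (forall B, measurable B ->
    (\int[P]_x (h x * \1_B (X x))%:E = c%:E * P (X @^-1` B))%E) ->
  (\int[P]_x (h x * g (X x))%:E =
   c%:E * \sum_(y <- fset_set (range g)) y%:E * P (X @^-1` (g @^-1` [set y])))%E.
Proof.
move=> mX mh h0 c0 hB.
pose F (y : R) (x : T) : R := h x * (y * \1_(g @^-1` [set y]) (X x)).
have F0 y x : 0 <= F y x.
  by rewrite mulr_ge0// -lee_fin EFinM nnfun_muleindic_ge0.
have mI y : measurable_fun setT (fun x => \1_(g @^-1` [set y]) (X x) : R).
  exact: measurableT_comp.
have mF y : measurable_fun setT (F y).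
  by apply: measurable_funM => //; exact: measurable_funM.
transitivity (\int[P]_x (\sum_(y <- fset_set (range g)) (F y x)%:E))%E.
  apply: eq_integral => x _.
  by rewrite fimfunE fsbig_finite//= mulr_sumr sumEFin.
rewrite ge0_integral_sum//; last 2 first.
  - by move=> y; exact/measurable_EFinP.
  - by move=> y x _; rewrite lee_fin.
rewrite ge0_sume_distrr; last first.
  move=> y _; apply: (mulemu_ge0 (fun y => X @^-1` (g @^-1` [set y]))) => y0.
  by rewrite (preimage_nnfun0 _ y0) preimage_set0.
apply: eq_bigr => y _.
(* A simple function is nonnegative, so the level set of a negative y is empty
   and both sides vanish. *)
have [y0|y0] := leP 0 y; last first.
  rewrite /F (preimage_nnfun0 _ y0) preimage_set0 measure0 !mule0.
  by rewrite integral0_eq// => x _; rewrite indic0 !mulr0.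
rewrite muleCA -hB// -ge0_integralZl_EFin//.
- by apply: eq_integral => x _; rewrite /F mulrCA EFinM.
- by move=> x _; rewrite lee_fin mulr_ge0.
- by apply/measurable_EFinP; exact: measurable_funM.
Qed.

(** The standard extension of an independence relation from events to
nonnegative functions, by monotone convergence along simple functions of X.
The factor h stands for everything that X is independent of. *)
Lemma integral_mul_indep_factor dT (T : measurableType dT) (R : realType)
    (P : {measure set T -> \bar R}) d' (T' : measurableType d')
    (X : T -> T') (h : T -> R) (f : T' -> R) (c : R) :
  measurable_fun setT X -> measurable_fun setT h -> measurable_fun setT f ->
  (forall x, 0 <= h x) -> (forall x, 0 <= f x) -> 0 <= c ->
  (forall B, measurable B ->
    (\int[P]_x (h x * \1_B (X x))%:E = c%:E * P (X @^-1` B))%E) ->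
  (\int[P]_x (h x * f (X x))%:E = c%:E * \int[P]_x (f (X x))%:E)%E.
Proof.
move=> mX mh mf h0 f0 c0 hB.
have mEf : measurable_fun setT (EFin \o f) by exact/measurable_EFinP.
pose g_ := nnsfun_approx measurableT mEf.
have nd_g y : {homo (fun n => g_ n y) : m n / (m <= n)%N >-> m <= n}.
  by move=> m n mn; exact/lefP/nd_nnsfun_approx.
have cvg_g y : (EFin \o (fun n => g_ n y)) @ \oo --> (f y)%:E.
  by apply: cvg_nnsfun_approx => // z _; rewrite lee_fin.
have mg n : measurable_fun setT (fun x => g_ n (X x)).
  exact: measurableT_comp.
have simple n : (\int[P]_x (h x * g_ n (X x))%:E
                 = c%:E * \int[P]_x (g_ n (X x))%:E)%E.
  rewrite (integral_mul_nnsfun _ mX mh h0 c0 hB); congr (_ * _)%E.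
  rewrite -[LHS]mul1e -(@integral_mul_nnsfun _ _ _ P _ _ X (cst 1) (g_ n) 1)//.
    by apply: eq_integral => x _; rewrite mul1r.
  move=> B mB; under eq_integral do rewrite mul1r.
  by rewrite mul1e integral_indic ?setIT// -[X in measurable X]setTI; exact: mX.
have -> : (\int[P]_x (h x * f (X x))%:E =
          limn (fun n => \int[P]_x (h x * g_ n (X x))%:E))%E.
  rewrite -monotone_convergence//.
  - apply: eq_integral => x _; apply/esym/cvg_lim => //.
    under eq_fun do rewrite EFinM.
    rewrite EFinM; apply: cvgeZl => //; exact: cvg_g.
  - by move=> n; exact/measurable_EFinP/measurable_funM.
  - by move=> n x _; rewrite lee_fin mulr_ge0.
  - by move=> x _ m n mn; rewrite lee_fin ler_wpM2l// nd_g.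
under eq_fun do rewrite simple.
apply/cvg_lim => //; apply: cvgeZl => //.
have -> : (\int[P]_x (f (X x))%:E = \int[P]_x limn (fun n => (g_ n (X x))%:E))%E.
  by apply: eq_integral => x _; apply/esym/cvg_lim => //; exact: cvg_g.
apply: cvg_monotone_convergence => //.
- by move=> n; exact/measurable_EFinP.
- by move=> n x _; rewrite lee_fin.
- by move=> x _ m n mn; rewrite lee_fin nd_g.
Qed.

Lemma prod_indic (T : Type) (R : realType) (I : eqType) (J : seq I)
    (A : I -> set T) (x : T) :
  \prod_(s <- J) (\1_(A s) x : R) = \1_(\bigcap_(s in [set` J]) A s) x.
Proof.
rewrite [RHS]indicE; have [/set_mem xA|] := boolP (x \in _).
  rewrite big_seq big1// => s sJ; rewrite indicE mem_set//.
  exact: (xA s).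
move=> /negP xA; apply/eqP; rewrite prodf_seq_eq0.
have : ~ (forall s, s \in J -> A s x).
  by move=> xA'; apply/xA/mem_set => s /xA'.
move=> /existsNP [s] /not_implyP [sJ sA].
by apply/hasP; exists s => //=; rewrite indicE memNset.
Qed.

(** Independence is given for events, so the induction replaces indicators by
functions one index at a time; J lists the indices already treated and J' those
that still carry an indicator. *)
Lemma independent_integral_prod dT (T : measurableType dT) (R : realType)
    (P : probability T R) d (xi : nat -> T -> 'rV[R]_d)
    (f : nat -> borel_rV R d -> R) (J J' : seq nat) (B : nat -> set 'rV[R]_d) :
  (forall s, random_vector (xi s)) -> independent P xi ->
  (forall s, measurable_fun setT (f s)) -> (forall s v, 0 <= f s v) ->
  (forall s, \int[P]_x (f s (xi s x))%:E < +oo)%E ->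
  (forall s, borel (B s)) -> uniq (J ++ J') ->
  (\int[P]_x (\prod_(s <- J) f s (xi s x) *
              \prod_(s <- J') \1_(B s) (xi s x))%:E =
   \prod_(s <- J) \int[P]_x (f s (xi s x))%:E *
   \prod_(s <- J') P (xi s @^-1` B s))%E.
Proof.
move=> rxi ind mf f0 fint.
have mxi s : measurable_fun setT (xi s : T -> borel_rV R d).
  exact: random_vector_measurable.
have mfxi s : measurable_fun setT (fun x => f s (xi s x)).
  exact: (measurableT_comp (mf s) (mxi s)).
have Ef0 s : (0 <= \int[P]_x (f s (xi s x))%:E)%E.
  by apply: integral_ge0 => x _; rewrite lee_fin.
elim: J J' B => [|s J IH] J' B mB.
  move=> /= uJ'; rewrite big_nil mul1e -ind//.
  have mB' : measurable (\bigcap_(s in [set` J']) (xi s @^-1` B s)).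
    by apply: bigcap_measurableType => s _; exact: rxi.
  rewrite -[X in P X]setIT -(integral_indic P measurableT mB').
  by apply: eq_integral => x _; rewrite big_nil mul1r -prod_indic.
rewrite /= mem_cat negb_or => /andP[/andP[sJ sJ'] uJ].
set c := (\prod_(s <- J) \int[P]_x (f s (xi s x))%:E *
          \prod_(s <- J') P (xi s @^-1` B s))%E.
have c_fin : c \is a fin_num.
  rewrite fin_numM ?prode_fin_num// => i _.
    by rewrite ge0_fin_numE.
  by rewrite fin_num_measure//; exact: rxi.
have c0 : (0 <= c)%E.
  by rewrite mule_ge0// prode_ge0.
rewrite big_cons -muleA -/c muleC -(fineK c_fin).
pose h x := \prod_(s <- J) f s (xi s x) * \prod_(s <- J') (\1_(B s) (xi s x) : R).
rewrite -(@integral_mul_indep_factor _ _ _ _ _ _ (xi s : T -> borel_rV R d) h).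
- apply: eq_integral => x _; congr (_%:E); rewrite /h big_cons.
  by rewrite -mulrA mulrC.
- exact: mxi.
- apply: measurable_funM; apply: measurable_prod => i _ //.
  have mBi : measurable (xi i @^-1` B i) by exact: rxi.
  have m1 : measurable_fun setT (\1_(xi i @^-1` B i) : T -> R).
    exact: measurable_indic.
  exact: m1.
- exact: mf.
- by move=> x; rewrite mulr_ge0// prodr_ge0.
- exact: f0.
- by rewrite fine_ge0.
move=> A mA; rewrite fineK//.
(* The family B does not constrain the index s, which lies outside J'; setting
   it to A turns the remaining factor into an instance of the hypothesis. *)
pose B' i := if i == s then A else B i.
have B'J i : i \in J' -> B' i = B i.
  by rewrite /B'; case: eqP => // -> sJ''; rewrite sJ'' in sJ'.
have B's : B' s = A by rewrite /B' eqxx.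
have := IH (s :: J') B'.
rewrite big_cons B's.
have -> : (\prod_(i <- J') P (xi i @^-1` B' i) = \prod_(i <- J') P (xi i @^-1` B i))%E.
  by apply: eq_big_seq => i /B'J->.
rewrite muleCA -/c muleC => <-.
- apply: eq_integral => x _; rewrite big_cons B's /h -mulrA; congr (_ * _)%:E.
  rewrite mulrC; congr (_ * _).
  by apply: eq_big_seq => i /B'J->.
- by move=> i; rewrite /B'; case: eqP.
- by rewrite (uniq_catCA J [:: s] J')/= mem_cat negb_or sJ sJ'.
Qed.

(** * Sub-Gaussian vectors *)

Lemma measurable_dot_rv dT (T : measurableType dT) (R : realType) d
    (X : T -> 'rV[R]_d) (u : 'rV[R]_d) :
  random_vector X -> measurable_fun setT (fun x => dot u (X x)).
Proof.
move=> /random_vector_measurable mX.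
exact: (measurableT_comp (measurable_dot u) mX).
Qed.

Lemma dot_mulmx_sum (R : realType) d (J : seq nat) (G : nat -> 'M[R]_d) (u : 'rV[R]_d) :
  dot (u *m \sum_(s <- J) G s) u = \sum_(s <- J) dot (u *m G s) u.
Proof. by rewrite mulmx_sumr dotC dot_sumr; apply: eq_bigr => s _; rewrite dotC. Qed.

(** Variance proxies of independent vectors add up, because the moment
generating function of the sum is the product of those of the summands. *)
Lemma subgaussian_mx_sum dT (T : measurableType dT) (R : realType)
    (P : probability T R) d (xi : nat -> T -> 'rV[R]_d) (G : nat -> 'M[R]_d)
    (J : seq nat) :
  (forall s, random_vector (xi s)) -> independent P xi ->
  (forall s, subgaussian_mx P (G s) (xi s)) -> uniq J ->
  subgaussian_mx P (\sum_(s <- J) G s) (fun x => \sum_(s <- J) xi s x).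
Proof.
move=> rxi ind sG uJ u.
have bound s : (\int[P]_x (expR (dot u (xi s x)))%:E
                <= (expR (dot (u *m G s) u / 2))%:E)%E.
  by have := sG s u; rewrite unlock.
rewrite unlock.
pose f (_ : nat) (v : borel_rV R d) : R := expR (dot u v).
have mf s : measurable_fun setT (f s).
  by apply: measurableT_comp => //; exact: measurable_dot.
have := @independent_integral_prod _ _ _ P _ xi f J [::] (fun=> setT) rxi ind mf.
rewrite cats0 big_nil mule1 => prodE.
have -> : (\int[P]_x (expR (dot u (\sum_(s <- J) xi s x)))%:E =
          \prod_(s <- J) \int[P]_x (expR (dot u (xi s x)))%:E)%E.
  rewrite -prodE//.
  - by apply: eq_integral => x _; rewrite big_nil mulr1 dot_sumr expR_sum.
  - by move=> s v; exact: expR_ge0.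
  - by move=> s; apply: le_lt_trans (bound s) (ltry _).
  - by move=> s; exact: (@measurableT _ (borel_rV R d)).
rewrite dot_mulmx_sum mulr_suml expR_sum -prodEFin.
elim: J {uJ prodE} => [|s J IH]; first by rewrite !big_nil.
rewrite !big_cons lee_pmul//.
- by apply: integral_ge0 => x _; rewrite lee_fin expR_ge0.
- by apply: prode_ge0 => i _; apply: integral_ge0 => x _; rewrite lee_fin expR_ge0.
Qed.

Lemma measurable_dot_sum dT (T : measurableType dT) (R : realType) d
    (xi : nat -> T -> 'rV[R]_d) (J : seq nat) :
  (forall s, random_vector (xi s)) ->
  forall u : 'rV_d, measurable_fun setT (fun x => dot u (\sum_(s <- J) xi s x)).
Proof.
move=> rxi u; under eq_fun do rewrite dot_sumr.
by apply: measurable_sum => s; exact: measurable_dot_rv.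
Qed.

(** Jensen's inequality for the convex function z |-> z^k.  The induction on k
uses that z |-> z^k and z are similarly ordered, so that
(z^k - m^k) * (z - m) >= 0 at the mean m. *)
Lemma jensen_expr (R : realType) (I : finType) (p z : I -> R) (k : nat) :
  (forall i, 0 <= p i) -> \sum_i p i = 1 -> (forall i, 0 <= z i) ->
  (\sum_i p i * z i) ^+ k <= \sum_i p i * z i ^+ k.
Proof.
move=> p0 p1 z0; set m := \sum_i p i * z i.
have m0 : 0 <= m by apply: sumr_ge0 => i _; apply: mulr_ge0.
elim: k => [|k IH].
  by under eq_bigr do rewrite expr0 mulr1; rewrite p1 expr0.
have tangent i : m ^+ k * z i + m * z i ^+ k - m ^+ k.+1 <= z i ^+ k.+1.
  suff : 0 <= (z i ^+ k - m ^+ k) * (z i - m) by rewrite !exprS; nra.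
  have [mz|/ltW zm] := leP m (z i).
    by apply: mulr_ge0; rewrite subr_ge0// lerXn2r// nnegrE.
  by apply: mulr_le0; rewrite subr_le0// lerXn2r// nnegrE.
apply: (@le_trans _ _ (\sum_i p i * (m ^+ k * z i + m * z i ^+ k - m ^+ k.+1))).
  rewrite (eq_bigr (fun i => m ^+ k * (p i * z i) + m * (p i * z i ^+ k)
                             - m ^+ k.+1 * p i)); last by move=> i _; ring.
  rewrite sumrB big_split/= -!mulr_sumr p1 -/m mulr1 -exprSr addrAC subrr add0r.
  by rewrite exprS ler_wpM2l.
by apply: ler_sum => i _; apply: ler_wpM2l.
Qed.

(** The n-th power of y / n <= exp (y / n). *)
Lemma expr_le_expR (R : realType) (n : nat) (y : R) :
  0 <= y -> y ^+ n <= n%:R ^+ n * expR y.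
Proof.
move=> y0; case: n => [|n].
  by rewrite !expr0 mul1r; apply: le_trans (expR_ge1Dx y); rewrite lerDl.
have n0 : (0 : R) < n.+1%:R by rewrite ltr0n.
rewrite (_ : expR y = expR (y / n.+1%:R) ^+ n.+1); last first.
  by rewrite -expRM_natr -mulrA mulVf ?mulr1// gt_eqF.
rewrite -exprMn lerXn2r ?nnegrE// ?mulr_ge0 ?expR_ge0//.
rewrite -{1}[y](@divfK _ n.+1%:R) ?gt_eqF// mulrC ler_pM2l//.
by apply: le_trans (expR_ge1Dx _); rewrite lerDr.
Qed.

Lemma sqrX_le_expR (R : realType) (k : nat) (s : R) :
  (s ^+ 2) ^+ k <= (2 * k)%:R ^+ (2 * k) * (expR s + expR (- s)).
Proof.
rewrite -real_normK ?num_real// -exprM.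
apply: le_trans (expr_le_expR _ (normr_ge0 s)) _.
rewrite ler_wpM2l ?exprn_ge0//.
by case: (ger0P s) => _; rewrite ?lerDl ?lerDr expR_ge0.
Qed.

(** Reduces the Euclidean norm to one-dimensional exponentials.  Writing
|a|^2 = G * sum_i (g_i / G) * (a_i^2 / g_i) with G the sum of the g_i, Jensen's
inequality for the k-th power makes |a|^(2k) a weighted average of the
(a_i^2 / g_i)^k, each of which is bounded by exponentials.  The rates
sqrt (2k / g_i) are such that a coordinate of variance proxy g_i has exponential
moments at most e^k, the same for all i. *)
Lemma l2_expr_le_expR (R : realType) d (a : 'rV[R]_d) (g : 'I_d -> R) (k : nat) :
  (0 < d)%N -> (0 < k)%N -> (forall i, 0 < g i) ->
  dot a a ^+ k <= ((2 * k)%:R * \sum_i g i) ^+ k *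
    \sum_i g i / (\sum_i g i) *
      (expR (Num.sqrt ((2 * k)%:R / g i) * a 0 i) +
       expR (- (Num.sqrt ((2 * k)%:R / g i) * a 0 i))).
Proof.
move=> d0 k0 g0; set G := \sum_i g i.
have G0 : 0 < G.
  case: d d0 a g g0 @G => // d _ a g g0 G.
  by rewrite /G big_ord_recl ltr_pwDl// sumr_ge0// => i _; exact/ltW.
have k2 : 0 < (2 * k)%:R :> R by rewrite ltr0n muln_gt0.
pose q i := a 0 i ^+ 2 / g i.
have q0 i : 0 <= q i by rewrite mulr_ge0 ?sqr_ge0// invr_ge0 ltW.
have -> : dot a a = G * \sum_i g i / G * q i.
  rewrite dotE mulr_sumr; apply: eq_bigr => i _; rewrite /q.
  by field; rewrite !gt_eqF.
rewrite !exprMn (mulrC ((2 * k)%:R ^+ k)) -mulrA ler_pM2l ?exprn_gt0//.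
apply: (@le_trans _ _ (\sum_i g i / G * q i ^+ k)).
  apply: jensen_expr => // [i|]; first by rewrite divr_ge0// ltW.
  by rewrite -mulr_suml divff// gt_eqF.
rewrite mulr_sumr; apply: ler_sum => i _.
rewrite mulrCA; apply: ler_wpM2l; first by rewrite divr_ge0 ?ltW.
set s := Num.sqrt _ * _.
have -> : q i = s ^+ 2 / (2 * k)%:R.
  rewrite /s exprMn sqr_sqrtr ?divr_ge0 ?ltW// /q.
  have kn0 : (2 * k)%:R != 0 :> R by rewrite gt_eqF.
  have gn0 : g i != 0 by rewrite gt_eqF.
  by move: ((2 * k)%:R : R) kn0 => K Kn0; field; rewrite Kn0 gn0.
rewrite expr_div_n ler_pdivrMr ?exprn_gt0//.
apply: le_trans (sqrX_le_expR _ _) _.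
by rewrite mul2n -addnn exprD mulrAC.
Qed.

(** exp z + exp (- z) >= 2 for every real z, so the expectation of the left-hand
side at z = <u, X>, which is at most twice the exponential of half the quadratic
form, is at least 2. *)
Lemma subgaussian_mx_ge0 dT (T : measurableType dT) (R : realType)
    (P : probability T R) d (X : T -> 'rV[R]_d) (G : 'M[R]_d) (u : 'rV[R]_d) :
  (forall u, measurable_fun setT (fun x => dot u (X x))) ->
  subgaussian_mx P G X -> 0 <= dot (u *m G) u.
Proof.
move=> mX sG.
have mE v : measurable_fun setT (fun x => (expR (dot v (X x)))%:E).
  by apply/measurable_EFinP; apply: measurableT_comp => //.
have E0 v x : setT x -> (0 <= (expR (dot v (X x)))%:E)%E.
  by rewrite lee_fin expR_ge0.
have le2 : (2%:E <= \int[P]_x ((expR (dot u (X x)))%:E + (expR (dot (- u) (X x)))%:E))%E.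
  have -> : (2%:E = \int[P]_x (cst 2%:E x))%E.
    rewrite integral_cst// -[LHS]mule1; congr (_ * _)%E.
    exact/esym/probability_setT.
  apply: ge0_le_integral => //.
  - by move=> x _; rewrite lee_fin.
  - exact: emeasurable_funD.
  - move=> x _; rewrite /= -EFinD lee_fin -scaleN1r dotZl mulN1r.
    have := expR_ge1Dx (dot u (X x)); have := expR_ge1Dx (- dot u (X x)); lra.
have := sG u; have := sG (- u); rewrite unlock => le_u le_Nu.
move: le2; rewrite ge0_integralD// => /le_trans/(_ (leeD le_Nu le_u)).
rewrite -EFinD lee_fin -scaleN1r -scalemxAl dotZl dotZr !mulN1r opprK.
move=> le2.
have : 0 <= dot (u *m G) u / 2 by rewrite -ler_expR expR0; lra.
by rewrite pmulr_lge0// invr_gt0.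
Qed.

Lemma measurable_dot_ge dT (T : measurableType dT) (R : realType) d
    (X : T -> 'rV[R]_d) (r : R) :
  (forall u, measurable_fun setT (fun x => dot u (X x))) ->
  measurable [set x | r <= dot (X x) (X x)].
Proof.
move=> mX.
have mcoord i : measurable_fun setT (fun x => X x 0 i).
  by under eq_fun do rewrite -dot_deltal; exact: mX.
have mXX : measurable_fun setT (fun x => dot (X x) (X x)).
  under eq_fun do rewrite dotE.
  by apply: measurable_sum => i; apply: measurable_funM.
rewrite (_ : [set x | _] = (fun x => dot (X x) (X x)) @^-1` `[r, +oo[).
  by rewrite -[X in measurable X]setTI; exact: mXX.
by apply/seteqP; split => x /=; rewrite in_itv/= andbT.
Qed.

(** Markov's inequality applied to the right-hand side of [l2_expr_le_expR].
The bound involves the trace of the proxy matrix only, whatever the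
dimension. *)
Lemma subgaussian_mx_tail dT (T : measurableType dT) (R : realType)
    (P : probability T R) d (X : T -> 'rV[R]_d) (G : 'M[R]_d) (tau2 : R) (k : nat) :
  (forall u, measurable_fun setT (fun x => dot u (X x))) ->
  subgaussian_mx P G X -> (0 < d)%N -> (0 < k)%N -> 0 < tau2 -> \tr G <= tau2 ->
  (P [set x | (4 * expR 2 * k%:R * tau2 <= dot (X x) (X x))%R]
   <= (2 * expR (- k%:R))%:E)%E.
Proof.
move=> mX sG d0 k0 tau0 trG.
have G0 i : 0 <= G i i.
  have := subgaussian_mx_ge0 (1 *: delta_mx 0 i) mX sG.
  by rewrite dot_delta_mulmx expr1n mul1r.
(* Diagonal entries of G may vanish; spreading tau2 evenly over the coordinates
   makes the proxies positive and at most doubles their sum. *)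
pose g i := G i i + tau2 / d%:R.
have dR0 : 0 < d%:R :> R by rewrite ltr0n.
have g0 i : 0 < g i by rewrite ltr_wpDl// divr_gt0.
pose S := \sum_i g i.
have S0 : 0 < S.
  rewrite /S; case: d d0 X G mX sG trG G0 g dR0 g0 S => // d' _ X G mX sG _ _ g _ g0 _.
  by rewrite big_ord_recl ltr_pwDl// sumr_ge0// => i _; exact/ltW.
have S2 : S <= 2 * tau2.
  rewrite /S big_split/= sumr_const card_ord -[X in _ + X <= _]mulr_natr divfK ?gt_eqF//.
  rewrite -/(\tr G); lra.
pose u i : R := Num.sqrt ((2 * k)%:R / g i).
pose Z x := \sum_i g i / S * (expR (u i * X x 0 i) + expR (- (u i * X x 0 i))).
have coordE (c : R) i x : expR (c * X x 0 i) = expR (dot (c *: delta_mx 0 i) (X x)).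
  by rewrite dotZl dot_deltal.
have mexp (c : R) i : measurable_fun setT (fun x => expR (c * X x 0 i)).
  under eq_fun do rewrite coordE.
  by apply: measurableT_comp => //.
have Eexp (c : R) i : c ^+ 2 = (2 * k)%:R / g i ->
    (\int[P]_x (expR (c * X x 0 i))%:E <= (expR k%:R)%:E)%E.
  move=> c2; under eq_integral do rewrite coordE.
  have := sG (c *: delta_mx 0 i); rewrite unlock => /le_trans; apply.
  rewrite lee_fin ler_expR dot_delta_mulmx c2 natrM.
  have : G i i / g i <= 1 by rewrite ler_pdivrMr// mul1r lerDl divr_ge0// ltW.
  have -> : 2 * k%:R / g i * G i i / 2 = k%:R * (G i i / g i).
    by field; rewrite gt_eqF.
  by move=> Gg_le1; rewrite ler_piMr.
have u2 i : u i ^+ 2 = (2 * k)%:R / g i by rewrite sqr_sqrtr ?divr_ge0// ltW.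
pose z i x := g i / S * (expR (u i * X x 0 i) + expR (- (u i * X x 0 i))).
have gS0 i : 0 <= g i / S by rewrite divr_ge0// ltW.
have z0 i x : 0 <= z i x by rewrite mulr_ge0// addr_ge0 ?expR_ge0.
have mz i : measurable_fun setT (z i).
  apply: measurable_funM => //; apply: measurable_funD; first exact: mexp.
  by under eq_fun do rewrite -mulNr; exact: mexp.
have e0 (c : R) i x : setT x -> (0 <= (expR (c * X x 0 i))%:E)%E.
  by rewrite lee_fin expR_ge0.
have mEexp (c : R) i : measurable_fun setT (fun x => (expR (c * X x 0 i))%:E).
  exact/measurable_EFinP/mexp.
have Ez i : (\int[P]_x (z i x)%:E <= (g i / S * (2 * expR k%:R))%:E)%E.
  under eq_integral do rewrite EFinM EFinD -mulNr.
  rewrite ge0_integralZl_EFin//; last 2 first.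
  - by move=> x _; rewrite lee_fin addr_ge0 ?expR_ge0.
  - by apply/measurable_EFinP; apply: measurable_funD; exact: mexp.
  rewrite ge0_integralD//.
  rewrite [X in (_ <= X)%E]EFinM lee_wpmul2l ?lee_fin// mulr2n mulrDl !mul1r EFinD.
  by apply: leeD; apply: Eexp; rewrite ?sqrrN u2.
have EZ : (\int[P]_x (Z x)%:E <= (2 * expR k%:R)%:E)%E.
  under eq_integral do rewrite /Z -sumEFin.
  rewrite ge0_integral_sum//; last 2 first.
  - by move=> i; apply/measurable_EFinP; exact: mz.
  - by move=> i x _; rewrite lee_fin; exact: z0.
  have -> : 2 * expR k%:R = \sum_i g i / S * (2 * expR k%:R).
    by rewrite -!mulr_suml divff ?gt_eqF// mul1r.
  by rewrite -sumEFin; apply: lee_sum => i _; exact: Ez.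
have mZ : measurable_fun setT Z by apply: measurable_sum => i; exact: mz.
have Z0 x : 0 <= Z x by apply: sumr_ge0 => i _; exact: z0.
set E := [set x | _].
have EZE : E `<=` [set x | ((expR (2 * k%:R))%:E <= `|(Z x)%:E|)%E].
  move=> x /= rX; rewrite lee_fin ger0_norm//.
  have := l2_expr_le_expR (X x) d0 k0 g0; rewrite -/S -/(Z x).
  have r0 : 0 <= (2 * k)%:R * S by rewrite mulr_ge0// ltW.
  have rle : expR 2 * ((2 * k)%:R * S) <= dot (X x) (X x).
    apply: le_trans rX.
    have -> : 4 * expR 2 * k%:R * tau2 = expR 2 * ((2 * k)%:R * (2 * tau2)).
      by rewrite natrM; ring.
    by rewrite ler_pM2l ?expR_gt0// ler_pM2l// ltr0n muln_gt0.
  have rpos : 0 < ((2 * k)%:R * S) ^+ k.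
    by rewrite exprn_gt0// mulr_gt0// ltr0n muln_gt0.
  have : (expR 2 * ((2 * k)%:R * S)) ^+ k <= dot (X x) (X x) ^+ k.
    by rewrite lerXn2r// nnegrE ?dot_ge0//; apply: mulr_ge0 => //; exact: expR_ge0.
  move=> /le_trans h /h.
  by rewrite exprMn mulrC ler_pM2l// expRM_natr.
have mE : measurable E by exact: measurable_dot_ge.
have mEZ : measurable_fun setT (EFin \o Z) by exact/measurable_EFinP.
have := le_integral_abse P measurableT mEZ (expR_gt0 (2 * k%:R)).
rewrite setTI => markov.
have le1 : ((expR (2 * k%:R))%:E * P E <= (2 * expR k%:R)%:E)%E.
  apply: le_trans EZ.
  under eq_integral => x _ do rewrite -[(Z x)%:E]gee0_abs ?lee_fin//.
  apply: le_trans markov.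
  rewrite lee_pmul2l ?lte_fin ?expR_gt0//.
  apply: le_measure => //; apply/mem_set => //.
  rewrite -[X in dT.-measurable X]setTI.
  by apply: emeasurable_fun_c_infty => //; exact: measurableT_comp.
have -> : 2 * expR (- k%:R) = expR (- (2 * k%:R)) * (2 * expR k%:R) :> R.
  by rewrite [RHS]mulrCA -expRD; congr (_ * expR _); ring.
by rewrite EFinM expRN lee_pdivlMl ?expR_gt0.
Qed.

(** Brings both kinds of proxy under a single hypothesis, a bound on the trace
of a matrix proxy. *)
Lemma subgaussian_trace dT (T : measurableType dT) (R : realType)
    (P : probability T R) d (pk : proxy_kind) (sigma : R) (X : T -> 'rV[R]_d) :
  subgaussian P pk sigma X ->
  exists G : 'M[R]_d,
    \tr G <= (sigma * dim_factor R pk d) ^+ 2 /\ subgaussian_mx P G X.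
Proof.
case: pk => /= [sX|[G trG sX]]; last by exists G; rewrite mulr1.
exists (sigma ^+ 2)%:M; split => //.
by rewrite mxtrace_scalar exprMn sqr_sqrtr// mulr_natr.
Qed.

(** The lower bound on the logarithm amounts to sqrt e <= 2. *)
Lemma confidence_log (R : realType) (alpha : R) : 0 < alpha < 1 ->
  1 / 2 <= ln (2 / alpha) /\ 2 * expR (- ln (2 / alpha)) = alpha.
Proof.
move=> /andP[a0 a1]; have x0 : 0 < 2 / alpha by rewrite divr_gt0.
split; last first.
  by rewrite expRN lnK// invf_div mulrC divfK.
rewrite -ler_expR lnK//.
have : 2^-1 <= expR (- (1 / 2)) :> R.
  by apply: le_trans (expR_ge1Dx _); lra.
rewrite expRN lef_pV2 ?posrE ?expR_gt0// => /le_trans; apply.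
by rewrite ler_pdivlMr//; lra.
Qed.

Lemma probability_setC_ge dT (T : measurableType dT) (R : realType) (P : probability T R)
    (B : set T) (a : R) :
  measurable B -> (P B <= a%:E)%E -> ((1 - a)%:E <= P (~` B))%E.
Proof.
by move=> mB PB; rewrite probability_setC// EFinB leeB.
Qed.

(** [subgaussian_mx_tail] with k the least integer above log (2 / alpha).  As
log (2 / alpha) >= 1/2, rounding up costs at most a factor 3. *)
Lemma noise_bound dT (T : measurableType dT) (R : realType) (P : probability T R)
    d (pk : proxy_kind) (sigma alpha : R) (xi : nat -> T -> 'rV[R]_d) (J : seq nat) :
  (0 < d)%N -> 0 < sigma -> 0 < alpha < 1 -> iid P xi ->
  (forall s, subgaussian P pk sigma (xi s)) -> uniq J -> (0 < size J)%N ->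
  prob_ge P [set a | dot (\sum_(s <- J) xi s a) (\sum_(s <- J) xi s a) <=
    12 * expR 2 * (size J)%:R * (sigma * dim_factor R pk d) ^+ 2 * ln (2 / alpha)]
    (1 - alpha).
Proof.
move=> d0 s0 a01 [rxi ind _] sg uJ J0.
have [l12 lE] := confidence_log a01; set l := ln _ in l12 lE *.
have l0 : 0 <= l by lra.
set tau := sigma * _.
have tau0 : 0 < tau.
  by rewrite mulr_gt0//; case: (pk) => //=; rewrite sqrtr_gt0 ltr0n.
have [G GP] := choice (fun s => subgaussian_trace (sg s)).
have mS := measurable_dot_sum J rxi.
have sS := subgaussian_mx_sum rxi ind (fun s => (GP s).2) uJ.
have trS : \tr (\sum_(s <- J) G s) <= (size J)%:R * tau ^+ 2.
  rewrite raddf_sum /= mulr_natl -[size J]count_predT -iter_addr_0 -big_const_seq.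
  by apply: ler_sum => s _; exact: (GP s).1.
have T0 : 0 < (size J)%:R * tau ^+ 2 by rewrite mulr_gt0 ?exprn_gt0// ltr0n.
pose k := (Num.truncn l).+1.
have lk : l < k%:R by exact: truncnS_gt.
have kl : k%:R <= 3 * l.
  have : (Num.truncn l)%:R <= l by rewrite truncn_le.
  by rewrite /k -natr1; lra.
have := subgaussian_mx_tail mS sS d0 (ltn0Sn _ : (0 < k)%N) T0 trS.
set B := [set x | _] => PB.
exists (~` B); split.
- by apply: measurableC; exact: measurable_dot_ge.
- move=> x /= /negP; rewrite -ltNge => /ltW /le_trans; apply.
  have -> : 12 * expR 2 * (size J)%:R * tau ^+ 2 * l =
            4 * expR 2 * (3 * l) * ((size J)%:R * tau ^+ 2) by ring.
  by rewrite ler_pM2r// ler_pM2l// mulr_gt0// expR_gt0.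
- apply: probability_setC_ge; first exact: measurable_dot_ge.
  apply: le_trans PB _; rewrite lee_fin -[X in _ <= X]lE ler_pM2l// ler_expR.
  by rewrite lerN2 ltW.
Qed.

(** * Window mean under drift *)

Definition window (W t : nat) : seq nat := index_iota (t.+1 - W) t.+1.

Lemma drift_bound (R : realType) d (nu : R) (omega : nat -> 'rV[R]_d) (s l : nat) :
  (forall s, l2norm (omega s.+1 - omega s) <= nu) ->
  l2norm (omega s - omega (s + l)%N) <= l%:R * nu.
Proof.
move=> drift; elim: l => [|l IH]; first by rewrite addn0 subrr l2norm0 mul0r.
rewrite (_ : _ - _ = (omega s - omega (s + l)%N)
                     + (-1) *: (omega (s + l).+1 - omega (s + l)%N)).
  apply: le_trans (ler_l2normD _ _) _.
  rewrite l2normZ normrN1 mul1r -natr1 mulrDl mul1r.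
  by apply: lerD.
by rewrite addnS scaleN1r opprB subrKA.
Qed.

Lemma window_mean_error (R : realType) d (W t : nat) (omega eta : nat -> 'rV[R]_d) :
  (0 < W)%N -> (W <= t.+1)%N ->
  window_mean W t (fun s => omega s + eta s) - omega t =
  W%:R^-1 *: \sum_(s <- window W t) (omega s - omega t) +
  W%:R^-1 *: \sum_(s <- window W t) eta s.
Proof.
move=> W0 Wt; rewrite /window_mean -/(window W t) big_split/= scalerDr addrAC.
congr (_ + _); rewrite sumrB scalerBr; congr (_ - _).
rewrite big_const_seq count_predT size_iota subKn// iter_addr_0.
by rewrite -[X in _ *: X]scaler_nat scalerA mulVf ?scale1r// pnatr_eq0 -lt0n.
Qed.

Lemma window_bias (R : realType) d (nu : R) (W t : nat) (omega : nat -> 'rV[R]_d) :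
  0 <= nu -> (forall s, l2norm (omega s.+1 - omega s) <= nu) ->
  (0 < W)%N -> (W <= t.+1)%N ->
  l2norm (W%:R^-1 *: \sum_(s <- window W t) (omega s - omega t)) <=
  (W%:R - 1) * nu.
Proof.
move=> nu0 drift W0 Wt; have WR0 : 0 < W%:R :> R by rewrite ltr0n.
rewrite l2normZ ger0_norm ?invr_ge0// mulrC ler_pdivrMr//.
apply: le_trans (ler_l2norm_sum _ _ _) _.
apply: (@le_trans _ _ (\sum_(s <- window W t) (W%:R - 1) * nu)); last first.
  rewrite big_const_seq count_predT size_iota subKn// iter_addr_0.
  by rewrite mulr_natr.
rewrite big_seq [X in _ <= X]big_seq; apply: ler_sum => s.
rewrite mem_index_iota ltnS => /andP[Ws st].
have := drift_bound s (t - s) drift; rewrite subnKC// => /le_trans; apply.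
rewrite ler_wpM2r// -(natrB _ W0) ler_nat leq_subCl; lia.
Qed.

(** * Balancing bias and noise *)

Lemma rounds_to_bounds (R : realType) (W : nat) (w : R) :
  0 < w -> rounds_to W w -> (W%:R - 1 <= w) /\ (w <= 2 * W%:R).
Proof.
move=> w0 [W0]; rewrite ltr_norml => /andP[h1 h2].
have : (1 : R) <= W%:R by rewrite ler1n.
by split; lra.
Qed.

Lemma cbrtK (R : realType) (x : R) : 0 <= x -> (x `^ (1 / 3)) ^+ 3 = x.
Proof.
by move=> x0; rewrite -powR_mulrn ?powR_ge0// -powRrM mulfVK ?powRr1.
Qed.

Lemma data_errorX3 (R : realType) (c sigma nu alpha : R) :
  0 <= sigma -> 0 <= nu -> 0 <= ln (2 / alpha) ->
  data_error c sigma nu alpha ^+ 3 = c ^+ 3 * sigma ^+ 2 * nu * ln (2 / alpha).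
Proof.
move=> s0 n0 l0; rewrite /data_error !exprMn !cbrtK//; congr (_ * _ * _ * _).
rewrite -[LHS]powR_mulrn ?powR_ge0// -powRrM (_ : 2 / 3 * 3%:R = 2%:R) ?powR_mulrn//.
by rewrite mulfVK.
Qed.

Lemma data_error_linear (R : realType) (c sigma nu alpha : R) :
  data_error c sigma nu alpha = c * data_error 1 sigma nu alpha.
Proof. by rewrite /data_error; ring. Qed.

Lemma data_error_ge0 (R : realType) (c sigma nu alpha : R) :
  0 <= c -> 0 <= data_error c sigma nu alpha.
Proof. by move=> c0; rewrite /data_error !mulr_ge0 ?powR_ge0. Qed.

(** With A^3 = sigma^2 nu log (2 / alpha) and w = Wstar, one has
(nu w)^3 = 2 A^3, hence nu w <= 2 A, and
sigma^2 log (2 / alpha) / w = (nu w)^2 / 2 <= 2 A^2.  Rounding w to an integer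
W >= 1 keeps W - 1 <= w and w <= 2 W. *)
Lemma window_balance (R : realType) (sigma nu alpha : R) (W : nat) :
  0 < sigma -> 0 < nu -> 0 < alpha < 1 -> rounds_to W (Wstar sigma nu alpha) ->
  let A := data_error 1 sigma nu alpha in
  (W%:R - 1) * nu <= 2 * A /\
  sigma ^+ 2 * ln (2 / alpha) <= 4 * A ^+ 2 * W%:R.
Proof.
move=> s0 n0 a01 rW A; have [l12 _] := confidence_log a01.
set l := ln _ in l12 *; have l0 : 0 < l by lra.
set w := Wstar _ _ _ in rW.
have wE : w ^+ 3 * nu ^+ 2 = 2 * sigma ^+ 2 * l.
  rewrite cbrtK ?divfK//; first by rewrite gt_eqF// exprn_gt0.
  by rewrite divr_ge0 ?sqr_ge0// !mulr_ge0 ?sqr_ge0// ltW.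
have w0 : 0 < w by rewrite powR_gt0// divr_gt0 ?exprn_gt0// !mulr_gt0// exprn_gt0.
have [W1 W2] := rounds_to_bounds w0 rW.
have A0 : 0 <= A by rewrite data_error_ge0.
have AE : A ^+ 3 = sigma ^+ 2 * nu * l.
  by rewrite data_errorX3 ?ltW// expr1n mul1r.
move: A A0 AE => A A0 AE.
have wA : nu * w <= 2 * A.
  rewrite -(@ler_pXn2r _ 3)// ?nnegrE ?mulr_ge0 ?(ltW n0) ?(ltW w0)//.
  rewrite !exprMn AE.
  have -> : nu ^+ 3 * w ^+ 3 = nu * (2 * sigma ^+ 2 * l) by rewrite -wE; ring.
  have : 0 <= sigma ^+ 2 * nu * l by rewrite -AE exprn_ge0.
  lra.
split.
  by apply: le_trans wA; rewrite mulrC ler_wpM2l// ltW.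
have h : sigma ^+ 2 * l <= 2 * A ^+ 2 * w.
  have -> : sigma ^+ 2 * l = (nu * w) ^+ 2 * w / 2.
    by apply: (@mulfI _ 2) => //; rewrite mulrA -wE; field.
  have : (nu * w) ^+ 2 <= (2 * A) ^+ 2.
    by rewrite lerXn2r// nnegrE mulr_ge0// ltW.
  by move=> h; nra.
apply: le_trans h _.
by have := sqr_ge0 A; nra.
Qed.

(** The bias is at most 2 A and the noise at most 7 e A times the dimension
factor, which is at least 1 as soon as d > 0 and can then be factored out of the
sum. *)
Lemma window_estimate dT (T : measurableType dT) (R : realType) (P : probability T R)
    d (pk : proxy_kind) (sigma nu alpha : R) (omega : nat -> 'rV[R]_d)
    (xi : nat -> T -> 'rV[R]_d) (t W : nat) :
  0 < nu -> (forall s, l2norm (omega s.+1 - omega s) <= nu) ->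
  0 < sigma -> iid P xi -> (forall s, subgaussian P pk sigma (xi s)) ->
  0 < alpha < 1 -> rounds_to W (Wstar sigma nu alpha) -> (W <= t.+1)%N ->
  prob_ge P [set a | l2norm (window_mean W t (fun s => omega s + xi s a) - omega t) <=
    data_error ((2 + 7 * expR 1) * dim_factor R pk d) sigma nu alpha] (1 - alpha).
Proof.
move=> nu0 drift s0 ixi sg a01 rW Wt; have W0 := rW.1.
set D := dim_factor R pk d.
have D0 : 0 <= D by rewrite /D; case: (pk) => //=; exact: sqrtr_ge0.
have e0 := expR_gt0 (1 : R).
(* For d = 0 the dimension factor of a directional proxy is 0, and so is every
   vector. *)
have [d0|d_gt0] := posnP d.
  exists setT; split => //.
    move=> a _ /=; move: omega xi drift ixi sg; rewrite d0 => omega xi _ _ _.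
    rewrite (_ : _ - _ = 0) ?l2norm0; last by rewrite [LHS]thinmx0.
    by rewrite data_error_ge0// mulr_ge0//; lra.
  by rewrite probability_setT lee_fin; case/andP: a01 => ? _; lra.
have D1 : 1 <= D.
  rewrite /D; case: (pk) => //=.
  by rewrite -[X in X <= _]sqrtr1 ler_wsqrtr// ler1n.
have size_w : size (window W t) = W by rewrite size_iota subKn.
have window_gt0 : (0 < size (window W t))%N by rewrite size_w.
have [E [mE Esub PE]] :=
  noise_bound d_gt0 s0 a01 ixi sg (iota_uniq _ _) window_gt0.
exists E; split => // a /Esub /=; rewrite size_w -/D.
have [bias noise] := window_balance s0 nu0 a01 rW.
rewrite data_error_linear; set A := data_error 1 _ _ _ in bias noise *.
have A0 : 0 <= A by rewrite data_error_ge0.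
move: A A0 bias noise => A A0 bias noise.
set l := ln _ in noise *; set S := \sum_(s <- _) _ => S_le.
rewrite window_mean_error//; apply: le_trans (ler_l2normD _ _) _.
have -> : (2 + 7 * expR 1) * D * A = 2 * D * A + 7 * expR 1 * D * A by ring.
apply: lerD.
  apply: le_trans (window_bias (ltW nu0) drift W0 Wt) _.
  by apply: le_trans bias _; rewrite -mulrA ler_pM2l// ler_peMl.
have WR0 : 0 < W%:R :> R by rewrite ltr0n.
rewrite l2normZ ger0_norm ?invr_ge0// mulrC ler_pdivrMr//.
rewrite -(@ler_pXn2r _ 2)// ?nnegrE ?l2norm_ge0//; last first.
  by rewrite !mulr_ge0// ltW.
rewrite l2norm_sqr; apply: le_trans S_le _.
have -> : expR 2 = expR 1 ^+ 2 :> R by rewrite -expRM_natr mul1r.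
have -> : 12 * expR 1 ^+ 2 * W%:R * (sigma * D) ^+ 2 * l =
  12 * (expR 1 * D) ^+ 2 * W%:R * (sigma ^+ 2 * l) by ring.
(* 7^2 = 12 * 4 + 1 *)
have -> : (7 * expR 1 * D * A * W%:R) ^+ 2 =
  12 * (expR 1 * D) ^+ 2 * W%:R * (4 * A ^+ 2 * W%:R) + (expR 1 * D * A * W%:R) ^+ 2 by ring.
apply: (@le_trans _ _ (12 * (expR 1 * D) ^+ 2 * W%:R * (4 * A ^+ 2 * W%:R))).
  by rewrite ler_wpM2l// !mulr_ge0// ?sqr_ge0// ltW.
by rewrite lerDl sqr_ge0.
Qed.

(** * Stability of the regime *)

Lemma same_side (R : realType) (x y c : R) :
  `|x - y| < `|x - c| -> ((x < c) = (y < c)) * ((c < x) = (c < y)).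
Proof.
move=> h; split; apply/idP/idP; move: h;
  by case: (ger0P (x - y)) => ?; case: (ger0P (x - c)) => ?; lra.
Qed.

(** The margin of a regime is a minimum over just the thresholds that define
its core, and a feature that moves by less than its distance to a threshold
stays on the same side. *)
Lemma core_stable (R : realType) m (delta theta gamma : R) k (r : regime)
    (lam lam' : 'rV[R]_m) :
  Num.max `|load lam - load lam'| (Num.max `|top_share k lam - top_share k lam'|
    (Num.max `|saturation delta lam - saturation delta lam'|
      `|second_share lam - second_share lam'|)) < margin delta theta gamma k r lam ->
  nneg lam' ->
  core delta theta gamma k r lam -> core delta theta gamma k r lam'.
Proof.
rewrite !gt_max => /and4P[hL hS hs ht] lam'0.
rewrite /core => /andP[_ coreP]; apply/andP; split; first exact/forallP.
move: hL hS hs ht coreP; case: r => //=; rewrite ?lt_min.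
- by move=> /same_side[<- _].
- by move=> /andP[/same_side[_ <-] _] /andP[_ /same_side[_ <-]].
- by move=> /andP[/same_side[_ <-] _] /and3P[_ /same_side[<- _] _]
    /and3P[_ _ /same_side[_ <-]].
- by move=> /andP[/same_side[_ <-] _] /and4P[_ /same_side[<- _] _ _]
    /and4P[_ _ /same_side[<- _] _] /and4P[_ _ _ /same_side[_ <-]].
Qed.

(** The cube of the error is c^3 sigma^2 nu log (2 / alpha), so the condition
on nu is the cube of the conclusion.  A vanishing c or CPsi * kappa makes
nu_max vanish and contradicts 0 < nu. *)
Lemma data_error_lt_margin (R : realType) (c sigma nu alpha rho CPsi kappa : R) :
  0 <= c -> 0 < sigma -> 0 < nu -> 0 < ln (2 / alpha) -> 0 < rho ->
  0 <= CPsi -> 0 <= kappa -> nu < nu_max c sigma alpha rho CPsi kappa ->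
  CPsi * (kappa * data_error c sigma nu alpha) < rho.
Proof.
rewrite /nu_max => c0 s0 n0; set l := ln _ => l0 r0 C0 k0 nu_lt.
have c_gt0 : 0 < c.
  rewrite lt_neqAle c0 andbT; apply/eqP => cE; move: nu_lt.
  by rewrite -cE expr0n/= !mul0r invr0 mulr0 mul0r ltNge ltW.
have Ck0 : 0 < CPsi * kappa.
  rewrite lt_neqAle mulr_ge0// andbT; apply/eqP => CkE; move: nu_lt.
  by rewrite -CkE invr0 mulr0 expr0n/= mulr0 ltNge ltW.
rewrite mulrA mulrC -ltr_pdivlMr//.
rewrite -(@ltr_pXn2r _ 3)// ?nnegrE ?data_error_ge0 ?divr_ge0 ?(ltW r0) ?(ltW Ck0)//.
rewrite data_errorX3 ?ltW// -/l.
move: nu_lt; rewrite mul1r mulrC ltr_pdivlMr; last by rewrite !mulr_gt0 ?exprn_gt0.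
by apply: le_lt_trans; rewrite le_eqVlt; apply/orP; left; apply/eqP; ring.
Qed.

(** * Tracking of the multiplier and of its regime *)

Theorem theorem15 (R : realType) :
  exists c1 : R, 0 < c1 /\
  forall (pk : proxy_kind) (n d m p : nat)
    (Omega : set 'rV[R]_d) (Q : program R n d m p)
    (lams : 'rV[R]_d -> 'rV[R]_m)
    (delta theta gamma : R) (k : nat)
    (dT : measure_display) (T : measurableType dT) (P : probability T R)
    (omega : nat -> 'rV[R]_d) (xi : nat -> T -> 'rV[R]_d)
    (sigma nu alpha kappa rho radius : R) (t W : nat),
  let c := c1 * dim_factor R pk d in
  let err := data_error c sigma nu alpha in
  let lam_t := lams (omega t) in
  let r_t := Psi delta theta gamma k lam_t in
  let y := fun (s : nat) (a : T) => omega s + xi s a in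
  let lam_hat := fun a : T => lams (window_mean W t (y ^~ a)) in
  (* the parametric program and its multiplier map *)
  C2_program Omega Q ->
  KKT_solution_map Omega Q lams ->
  (forall s, Omega (omega s)) ->
  regular_at Q (omega t) lam_t ->
  (* regime parameters *)
  0 < delta < 1 / 2 -> 1 / 2 < theta < 1 -> 0 < gamma < 1 ->
  (1 <= k <= m.-1)%N ->
  (* drift and noise *)
  0 < nu -> (forall s, l2norm (omega s.+1 - omega s) <= nu) ->
  0 < sigma -> iid P xi -> (forall s, subgaussian P pk sigma (xi s)) ->
  (* confidence level and window *)
  0 < alpha < 1 -> rounds_to W (Wstar sigma nu alpha) -> (W <= t.+1)%N ->
  (* kappa is a Lipschitz constant of the multiplier map near omega t, on a
     neighbourhood inside Omega covering the estimation error *)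
  0 <= kappa -> err <= radius -> l2ball (omega t) radius `<=` Omega ->
  l2lipschitz kappa (l2ball (omega t) radius) lams ->
  (* margin at time t *)
  core delta theta gamma k r_t lam_t -> 0 < rho ->
  rho <= margin delta theta gamma k r_t lam_t ->
  prob_ge P [set a | l2norm (lam_hat a - lam_t) <= kappa * err] (1 - alpha) /\
  (forall CPsi radius' : R,
     (* CPsi is a Lipschitz constant of the regime features on a bounded
        neighbourhood of lam_t in the orthant covering the multiplier error *)
     0 <= CPsi -> kappa * err <= radius' ->
     features_lipschitz delta k CPsi (l2ball lam_t radius' `&` @nneg R m) ->
     nu < nu_max c sigma alpha rho CPsi kappa ->
     prob_ge P [set a | Psi delta theta gamma k (lam_hat a) = r_t]
       (1 - alpha)).
Proof.
exists (2 + 7 * expR 1); split; first by have := expR_gt0 (1 : R); lra.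
move=> pk n d m p Omega Q lams delta theta gamma k dT T P omega xi sigma nu alpha
  kappa rho radius t W c err lam_t r_t y lam_hat _ KKTmap _ _ _ _ _ _ nu0 drift
  sigma0 xi_iid xi_sg alpha01 rW Wt kappa0 err_le ballOmega lams_lip core_t rho0
  rho_le.
have c0 : 0 <= c.
  apply: mulr_ge0; first by have := expR_gt0 (1 : R); lra.
  by case: (pk) => //=; exact: sqrtr_ge0.
have [E [mE E_err PE]] :=
  window_estimate nu0 drift sigma0 xi_iid xi_sg alpha01 rW Wt.
have in_ball a : E a -> l2ball (omega t) radius (window_mean W t (y ^~ a)).
  by move=> /E_err/= h; exact: le_trans h err_le.
have center : l2ball (omega t) radius (omega t).
  rewrite /l2ball/= subrr l2norm0; apply: le_trans err_le.
  exact: data_error_ge0.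
have lam_err a : E a -> l2norm (lam_hat a - lam_t) <= kappa * err.
  move=> Ea; apply: le_trans (lams_lip _ _ (in_ball _ Ea) center) _.
  by rewrite ler_wpM2l//; exact: E_err.
have lams_nneg w : l2ball (omega t) radius w -> nneg (lams w).
  by move=> /ballOmega/KKTmap[x [mu [_ ineq _]]] i; case: (ineq i).
split; first by exists E.
move=> CPsi radius' CPsi0 le_radius' feat_lip nu_lt.
exists E; split => // a Ea /=.
have r_neq : r_t <> hyb.
  by move=> r_hyb; move: core_t; rewrite r_hyb /core/= andbF.
apply/PsiP => //; apply: core_stable core_t; last exact/lams_nneg/in_ball.
apply: (@le_lt_trans _ _ (CPsi * (kappa * err))); last first.
  apply: lt_le_trans rho_le; apply: data_error_lt_margin => //.
  by have [] := confidence_log alpha01; lra.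
have lam_err' : l2norm (lam_t - lam_hat a) <= kappa * err.
  by rewrite -opprB -scaleN1r l2normZ normrN1 mul1r; exact: lam_err.
apply: (le_trans (feat_lip _ _ _ _)).
- split; last exact: lams_nneg.
  rewrite /l2ball/= subrr l2norm0; apply: le_trans le_radius'.
  by rewrite mulr_ge0// data_error_ge0.
- split; last exact/lams_nneg/in_ball.
  by apply: le_trans le_radius'; exact: lam_err.
- by rewrite ler_wpM2l.
Qed.
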